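(* Let $X$ and $R$ be finite sets, $\mathcal F$ a finite family of functions $f:X\to\{0,1\}$, $\mathcal D$ a probability distribution on $\mathcal F$ assigning probability $P_f$ to $f$, and $G:\mathcal F\times R\to X$ a heuristic. For $f\in\mathcal F$ let $h_f=|\{r\in R: f(G(f,r))=1\}|$, and assume $h_f>0$ whenever $P_f>0$. Let $T=\sum_{f\in\mathcal F}P_f\,|R|/h_f$ be the expected number of evaluations of $r\mapsto f(G(f,r))$ used by the classical procedure that repeatedly picks a uniformly random seed $r\in R$ until $f(G(f,r))=1$, for $f$ drawn from $\mathcal D$. Then there is a quantum algorithm that, for $f$ drawn from $\mathcal D$, finds $x_0\in X$ with $f(x_0)=1$ using an expected number (over $\mathcal D$ and the algorithm's randomness) of evaluations of $r\mapsto f(G(f,r))$ that is in $O(\sqrt T)$.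
   Context: Evaluations of $r\mapsto f(G(f,r))$ by the quantum algorithm may be made in superposition (as the reversible/unitary implementation of this Boolean function on the seed register). *)

(* Defs.v *)
From HB Require Import structures.
From mathcomp Require Import all_boot all_order all_algebra.
From mathcomp Require Import reals.
From mathcomp Require Import complex.
Set Implicit Arguments. Unset Strict Implicit. Unset Printing Implicit Defensive.
Import Order.TTheory GRing.Theory Num.Theory.
Local Open Scope ring_scope.

(* The quantum register of an algorithm is spanned by the basis states   *)
(*   S := Rs * bool * W                                                  *)
(* (seed register, oracle answer bit, workspace W : finType).            *)

Section QModel.
Variable R : realType.
Local Notation C := R[i].

Definition qstate (S : finType) := S -> C.
Definition qop (S : finType) := S -> S -> C.

Definition qapply (S : finType) (M : qop S) (psi : qstate S) : qstate S :=
  fun s => \sum_(t : S) M s t * psi t.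

(* M is unitary: M^dagger M = Id (equivalent to unitarity in finite dimension). *)
Definition unitary (S : finType) (M : qop S) : Prop :=
  forall s t : S, \sum_(u : S) (conjc (M u s)) * M u t = (s == t)%:R.

Definition ket (S : finType) (s0 : S) : qstate S := fun s => (s == s0)%:R.

Definition sqmod (z : C) : R := (complex.Re z) ^+ 2 + (complex.Im z) ^+ 2.

(* The standard (bit-flip) oracle for g : Rs -> bool acting on the seed
   register and the answer bit:  |r, b, w>  |->  |r, b xor g r, w>.  This is
   the reversible implementation of r |-> g r on the seed register. *)
Definition oracle (Rs W : finType) (g : Rs -> bool) : qop (Rs * bool * W)%type :=
  fun s t => ((s.1.1 == t.1.1) && (s.1.2 == t.1.2 (+) g t.1.1) && (s.2 == t.2))%:R.

(* One round: start in the basis state [rinit], apply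
     U_k O U_{k-1} O ... U_1 O U_0
   (k = rq oracle calls), then measure the whole register in the
   computational basis. *)
Record qround (Rs W : finType) := QRound {
  rq : nat;
  rinit : (Rs * bool * W)%type;
  ru : nat -> qop (Rs * bool * W)%type
}.

Fixpoint run_from (Rs W : finType) (g : Rs -> bool) (u : nat -> qop (Rs * bool * W)%type)
    (k : nat) (psi : qstate (Rs * bool * W)%type) : qstate (Rs * bool * W)%type :=
  match k with
  | 0 => qapply (u 0%N) psi
  | k'.+1 => qapply (u k) (qapply (@oracle Rs W g) (run_from g u k' psi))
  end.

Definition round_state (Rs W : finType) (g : Rs -> bool) (rd : qround Rs W) :=
  run_from g (ru rd) (rq rd) (ket (rinit rd)).

Definition round_wf (Rs W : finType) (rd : qround Rs W) : Prop :=
  forall j, (j <= rq rd)%N -> unitary (ru rd j).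

Definition outprob (Rs W : finType) (g : Rs -> bool) (rd : qround Rs W)
    (s : (Rs * bool * W)%type) : R :=
  sqmod (round_state g rd s).

(* An action of the classical controller: either stop and output a seed
   r (the found point being x0 = G(f, r)), or run a quantum round. *)
Inductive qaction (Rs W : finType) :=
  | QStop of Rs
  | QRun of qround Rs W.

(* A (Las Vegas) quantum algorithm: a classical controller that, given the
   history of all previous measurement outcomes, decides what to do next.
   Classical randomness is available through measurement outcomes. *)
Definition qalgo (Rs W : finType) := seq (Rs * bool * W)%type -> qaction Rs W.

Definition qalgo_wf (Rs W : finType) (A : qalgo Rs W) : Prop :=
  forall h, match A h with QRun rd => round_wf rd | QStop _ => True end.

Fixpoint hprob_from (Rs W : finType) (A : qalgo Rs W) (g : Rs -> bool)
    (pre h : seq (Rs * bool * W)%type) : R :=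
  match h with
  | [::] => 1
  | s :: h' =>
      match A pre with
      | QStop _ => 0
      | QRun rd => outprob g rd s * hprob_from A g (rcons pre s) h'
      end
  end.

Definition hprob (Rs W : finType) (A : qalgo Rs W) (g : Rs -> bool)
    (h : seq (Rs * bool * W)%type) : R := hprob_from A g [::] h.

Definition action_cost (Rs W : finType) (a : qaction Rs W) : nat :=
  match a with QStop _ => 0%N | QRun rd => rq rd end.

Definition action_success (Rs W : finType) (g : Rs -> bool) (a : qaction Rs W) : bool :=
  match a with QStop r => g r | QRun _ => false end.

(* Expected number of oracle calls made in the first n rounds.
   The expected number of oracle calls of A is the supremum over n. *)
Definition exp_cost_upto (Rs W : finType) (A : qalgo Rs W) (g : Rs -> bool) (n : nat) : R :=
  \sum_(m < n) \sum_(h : m.-tuple (Rs * bool * W)%type)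
     hprob A g h * (action_cost (A h))%:R.

Definition succ_upto (Rs W : finType) (A : qalgo Rs W) (g : Rs -> bool) (n : nat) : R :=
  \sum_(m < n.+1) \sum_(h : m.-tuple (Rs * bool * W)%type)
     hprob A g h * (action_success g (A h))%:R.

End QModel.

Definition hcount (X Rs : finType) (G : {ffun X -> bool} -> Rs -> X)
    (f : {ffun X -> bool}) : nat :=
  #|[set r : Rs | f (G f r)]|.

Definition classical_T (R : realType) (X Rs : finType) (Fam : {set {ffun X -> bool}})
    (P : {ffun X -> bool} -> R) (G : {ffun X -> bool} -> Rs -> X) : R :=
  \sum_(f in Fam) P f * (#|Rs|%:R / (hcount G f)%:R).

(* Main.v *)
(* Amplitude amplification with j iterations turns the success amplitude
   s = sin theta = sqrt (h / N) into sin ((2j + 1) theta).  Taking 2j + 1 = 3^k,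
   the amplitudes are the iterates of sin x |-> sin 3x = s (3 - 4 s^2), so the
   first k at which the amplitude exceeds 1/2 satisfies 3^k = O(sqrt (N / h)).
   This k is unknown, so round t uses the scale i = v_2(t + 1): scale i costs
   O(3^i) and has frequency 2^-(i+1), hence the first 2^m rounds cost
   sum_(i <= m) 3^i 2^(m-i) = O(3^m), while the probability of surviving them is
   doubly exponentially small in m - k.  The expected cost is thus O(3^k).
   Averaging over f is Jensen's inequality for the square root. *)
Require Import Defs.
From HB Require Import structures.
From mathcomp Require Import all_boot all_order all_algebra.
From mathcomp Require Import reals.
From mathcomp Require Import complex.
From mathcomp Require Import ring lra.
Set Implicit Arguments. Unset Strict Implicit. Unset Printing Implicit Defensive.
Import Order.TTheory GRing.Theory Num.Theory.
Local Open Scope ring_scope.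

(** * The ruler schedule of scales: survival probabilities and expected cost *)

Definition ruler (t : nat) : nat := logn 2 t.+1.

Lemma ruler_double (u : nat) : ruler u.*2 = 0%N.
Proof.
rewrite /ruler; case: (posnP (logn 2 u.*2.+1)) => // h.
by have : (2 %| u.*2.+1)%N by [rewrite -(expn1 2) pfactor_dvdn]; rewrite dvdn2 /= odd_double.
Qed.

Lemma ruler_doubleS (u : nat) : ruler u.*2.+1 = (ruler u).+1.
Proof. by rewrite /ruler -doubleS -muln2 lognM // addn1. Qed.

(** Since [2 ^ ruler u] divides [u.+1], one has [3 ^ ruler u <= 4 ^ ruler u <= u.+1 ^ 2]. Round
    costs thus grow only polynomially, and geometric decay of the survival probability beats
    them. *)
Lemma expn_ruler (u : nat) : (3 ^ ruler u <= u.+1 ^ 2)%N.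
Proof.
have h : (2 ^ ruler u <= u.+1)%N by apply: dvdn_leq => //; exact: pfactor_dvdnn.
apply: (@leq_trans (4 ^ ruler u)%N); first by case: (ruler u) => // n; rewrite leq_exp2r.
by rewrite -[4%N]/(2 ^ 2)%N -expnM mulnC expnM leq_exp2r.
Qed.

Definition failprob (R : realType) (q : nat -> R) (m : nat) : R :=
  \prod_(t < m) (1 - q (ruler t)).

Section Ruler.
Variable R : realType.
Implicit Type q : nat -> R.

Lemma failprob_ge0 q m : (forall i, q i <= 1) -> 0 <= failprob q m.
Proof. by move=> q1; apply: prodr_ge0 => t _; rewrite subr_ge0. Qed.

Lemma failprobS q m : failprob q m.+1 = failprob q m * (1 - q (ruler m)).
Proof. by rewrite /failprob big_ord_recr. Qed.

Lemma failprob_double q m :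
  failprob q m.*2 = (1 - q 0%N) ^+ m * failprob (q \o S) m.
Proof.
elim: m => [|m ih]; first by rewrite /failprob !big_ord0 expr0 mulr1.
by rewrite doubleS !failprobS ih ruler_double ruler_doubleS exprS /=; ring.
Qed.

Lemma sum_double (F : nat -> R) n :
  \sum_(m < n.*2) F m = \sum_(u < n) (F u.*2 + F u.*2.+1).
Proof.
elim: n => [|n ih]; first by rewrite !big_ord0.
by rewrite doubleS !big_ord_recr /= ih addrA.
Qed.

(* Rounds 2u run scale 0 and rounds 2u+1 run scale 1 + ruler u, so pairing them
   gives the same schedule with all scales shifted by one. *)
Lemma sum_failprob_le q (w : nat -> R) n :
  (forall i, 0 <= q i <= 1) -> (forall i, 0 <= w i) ->
  \sum_(m < n) failprob q m * w (ruler m) <=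
  \sum_(u < n) (1 - q 0%N) ^+ u * (failprob (q \o S) u * (w 0%N + w (ruler u).+1)).
Proof.
move=> q01 w0.
have q1 i : q i <= 1 by case/andP: (q01 i).
apply: (@le_trans _ _ (\sum_(m < n.*2) failprob q m * w (ruler m))).
  rewrite -!(big_mkord xpredT (fun m => failprob q m * w (ruler m))).
  rewrite [leRHS](big_cat_nat _ (n := n)) //=; last by rewrite -addnn leq_addr.
  by rewrite lerDl sumr_ge0 // => i _; rewrite mulr_ge0 // failprob_ge0.
rewrite (sum_double (fun m => failprob q m * w (ruler m))).
apply: ler_sum => u _; rewrite failprobS ruler_double ruler_doubleS failprob_double.
rewrite -!mulrA -!mulrDr.
apply: ler_wpM2l; first by rewrite exprn_ge0 // subr_ge0.
apply: ler_wpM2l; first by rewrite failprob_ge0 //= => i.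
by rewrite lerD2l ler_piMl // lerBlDr lerDl; case/andP: (q01 0%N).
Qed.


Lemma failprob_le1 q m : (forall i, 0 <= q i <= 1) -> failprob q m <= 1.
Proof.
move=> q01; apply: prodr_ile1 => i _.
by case/andP: (q01 (ruler i)) => h0 h1; apply/andP; split; lra.
Qed.

Lemma failprob_antitone q m n : (forall i, 0 <= q i <= 1) -> (m <= n)%N ->
  failprob q n <= failprob q m.
Proof.
move=> q01 /subnKC <-; elim: (n - m)%N => [|d ih]; first by rewrite addn0.
rewrite addnS failprobS; apply: le_trans ih.
have [h0 h1] := andP (q01 (ruler (m + d)%N)).
rewrite ler_piMr //; last lra.
by apply: failprob_ge0 => i; case/andP: (q01 i).
Qed.

Lemma sum_geom_weight n :
  \sum_(u < n) (3%:R / 4%:R) ^+ u * (1 + 3%:R * u.+1%:R ^+ 2) <= 340%:R :> R.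
Proof.
(* With p(n) = 12 n^2 + 96 n + 340 one has p(n) - 3/4 p(n+1) = 1 + 3 (n+1)^2, so adding (3/4)^n p(n)
   makes the sum telescope to p(0) = 340. *)
suff h : \sum_(u < n) (3%:R / 4%:R) ^+ u * (1 + 3%:R * u.+1%:R ^+ 2)
    + (3%:R / 4%:R) ^+ n * (12%:R * n%:R ^+ 2 + 96%:R * n%:R + 340%:R) <= 340%:R :> R.
  apply: le_trans h; rewrite lerDl mulr_ge0 ?exprn_ge0 ?divr_ge0 //.
  by have n0 : 0 <= n%:R :> R by []; nra.
elim: n => [|n ih]; first by rewrite big_ord0 expr0; lra.
rewrite big_ord_recr /= [_ ^+ n.+1]exprS; apply: le_trans ih.
have a0 : 0 <= (3%:R / 4%:R) ^+ n :> R by rewrite exprn_ge0 ?divr_ge0.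
rewrite -!(natr1 n); have n0 : 0 <= n%:R :> R by [].
move: a0 n0; move: ((3%:R / 4%:R) ^+ n) (n%:R) (\sum_(_ < n) _) => a x S a0 x0.
suff : 0 <= a * ((12%:R * x ^+ 2 + 96%:R * x + 340%:R) - (1 + 3%:R * (x + 1) ^+ 2)
   - 3%:R / 4%:R * (12%:R * (x + 1) ^+ 2 + 96%:R * (x + 1) + 340%:R)) by lra.
by rewrite mulr_ge0 //; lra.
Qed.

Lemma sum_geom n : \sum_(u < n) (3%:R / 4%:R) ^+ u <= 4%:R :> R.
Proof.
suff -> : \sum_(u < n) (3%:R / 4%:R) ^+ u = 4%:R - 4%:R * (3%:R / 4%:R) ^+ n :> R.
  by rewrite lerBlDr lerDl mulr_ge0 // exprn_ge0 // divr_ge0.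
elim: n => [|n ih]; first by rewrite big_ord0; lra.
by rewrite big_ord_recr /= ih exprS; lra.
Qed.

(** Bounds the expected number of rounds. For k = 0 each pair of rounds survives with probability at
    most 3/4, giving 2 * 4 = 8. Otherwise the rounds at scale 0 are counted as useless: shifting the
    scales lowers k by one and doubles the number of rounds. *)
Lemma sum_failprob q k n : (forall i, 0 <= q i <= 1) -> 1 / 4%:R <= q k ->
  \sum_(m < n) failprob q m <= 8%:R * 2%:R ^+ k.
Proof.
elim: k q n => [|k ih] q n q01 qk.
  have q01' i : 0 <= (q \o S) i <= 1 by exact: q01.
  have := @sum_failprob_le q (fun=> 1) n q01 (fun=> ler01).
  under eq_bigr => u _ do rewrite mulr1.
  move/le_trans; apply.
  apply: (@le_trans _ _ (2%:R * \sum_(u < n) (3%:R / 4%:R) ^+ u)); last first.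
    by have := sum_geom n; rewrite expr0; lra.
  rewrite mulr_sumr; apply: ler_sum => u _.
  rewrite [leRHS]mulrC; apply: ler_pM => //.
  - by rewrite exprn_ge0 // subr_ge0; case/andP: (q01 0%N).
  - by apply: mulr_ge0; [apply: failprob_ge0 => i; case/andP: (q01' i) | lra].
  - by rewrite lerXn2r ?nnegrE //; case/andP: (q01 0%N) => *; lra.
  - by have := failprob_le1 u q01'; lra.
have := @sum_failprob_le q (fun=> 1) n q01 (fun=> ler01).
under eq_bigr => u _ do rewrite mulr1.
move/le_trans; apply.
have q01' i : 0 <= (q \o S) i <= 1 by exact: q01.
have {}ih := ih (q \o S) n q01' qk.
apply: (@le_trans _ _ (2%:R * \sum_(u < n) failprob (q \o S) u)); last first.
  by rewrite exprS; lra.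
rewrite mulr_sumr; apply: ler_sum => u _.
have f0 : 0 <= failprob (q \o S) u by apply: failprob_ge0 => i; case/andP: (q01' i).
have [q0 q1] := andP (q01 0%N).
rewrite mulrCA [leRHS]mulrC ler_wpM2l // -[leRHS]mul1r; apply: ler_wpM2r; first lra.
by rewrite exprn_ile1 //; lra.
Qed.

(** Shifting the scales turns a cost C into A + 3 C, where A <= 8 * 2^k counts the interleaved
    rounds at scale 0. The negative term absorbs A exactly: 8 * 2^k - 3 * 8 * 2^k = - 8 * 2^(k+1).
    The base case is 348 - 8 = 340. *)
Lemma sum_failprob_cost q k n : (forall i, 0 <= q i <= 1) -> 1 / 4%:R <= q k ->
  \sum_(m < n) failprob q m * 3%:R ^+ ruler m <= 348%:R * 3%:R ^+ k - 8%:R * 2%:R ^+ k.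
Proof.
have w0 i : 0 <= 3%:R ^+ i :> R by rewrite exprn_ge0.
elim: k q n => [|k ih] q n q01 qk.
  have q01' i : 0 <= (q \o S) i <= 1 by exact: q01.
  have := @sum_failprob_le q (fun i => 3%:R ^+ i) n q01 w0; move/le_trans; apply.
  apply: (@le_trans _ _ (\sum_(u < n) (3%:R / 4%:R) ^+ u * (1 + 3%:R * u.+1%:R ^+ 2))); last first.
    by have := sum_geom_weight n; rewrite !expr0; lra.
  have f0 u : 0 <= failprob (q \o S) u by apply: failprob_ge0 => i; case/andP: (q01' i).
  apply: ler_sum => u _.
  apply: ler_pM => //.
  - by rewrite exprn_ge0 // subr_ge0; case/andP: (q01 0%N).
  - by rewrite mulr_ge0 // addr_ge0.
  - by rewrite lerXn2r ?nnegrE //; case/andP: (q01 0%N) => *; lra.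
  rewrite -[leRHS]mul1r; apply: ler_pM => //; first by rewrite addr_ge0.
    exact: failprob_le1.
  rewrite expr0 exprS lerD2l ler_pM2l // -!natrX ler_nat.
  exact: expn_ruler.
have := @sum_failprob_le q (fun i => 3%:R ^+ i) n q01 w0; move/le_trans; apply.
have q01' i : 0 <= (q \o S) i <= 1 by exact: q01.
have {}ih := ih (q \o S) n q01' qk.
have f0 u : 0 <= failprob (q \o S) u by apply: failprob_ge0 => i; case/andP: (q01' i).
have [q0 q1] := andP (q01 0%N).
have hA := sum_failprob n q01' (qk : 1 / 4%:R <= (q \o S) k).
apply: (@le_trans _ _ (\sum_(u < n) failprob (q \o S) u +
    3%:R * \sum_(u < n) failprob (q \o S) u * 3%:R ^+ ruler u)); last first.
  by rewrite !exprS; lra.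
rewrite mulr_sumr -big_split; apply: ler_sum => u _ /=.
rewrite expr0 exprS.
have -> : failprob (q \o S) u + 3%:R * (failprob (q \o S) u * 3%:R ^+ ruler u)
   = 1 * (failprob (q \o S) u * (1 + 3%:R * 3%:R ^+ ruler u)) by ring.
apply: ler_wpM2r; first by rewrite mulr_ge0 // addr_ge0 // mulr_ge0.
by rewrite exprn_ile1 //; lra.
Qed.

(** The survival probabilities decrease and their partial sums stay below 8 * 2^k, so n times the
    n-th one is at most 8 * 2^k. *)
Lemma failprob_cvg0 q k eps : (forall i, 0 <= q i <= 1) -> 1 / 4%:R <= q k ->
  0 < eps -> exists n, failprob q n <= eps.
Proof.
move=> q01 qk e0.
have [n] : exists n : nat, 8%:R * 2%:R ^+ k / eps < n%:R.
  by exists (Num.truncn (8%:R * 2%:R ^+ k / eps)).+1; rewrite truncnS_gt.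
rewrite ltr_pdivrMr // => hn; exists n.
have hs := sum_failprob n q01 qk.
have : n%:R * failprob q n <= 8%:R * 2%:R ^+ k.
  apply: le_trans hs; rewrite mulr_natl -[X in _ *+ X]card_ord -sumr_const.
  by apply: ler_sum => m _; apply: failprob_antitone => //; exact: ltnW.
move=> h; have n0 : 0 < n%:R :> R.
  by rewrite -(pmulr_lgt0 _ e0); apply: le_lt_trans hn; rewrite mulr_ge0 // exprn_ge0.
by rewrite -(ler_pM2l n0); apply: le_trans h (ltW hn).
Qed.

End Ruler.

(** * Growth of an amplitude under the triple-angle map *)

Section Tripling.
Variable R : realType.

Definition triple (s : R) : R := s * (3%:R - 4%:R * s ^+ 2).

(* [s + 4/5 s^3] is a polynomial substitute for [asin s]: it at least triples
   under [sin x |-> sin 3x] as long as [sin x <= 1/2]. *)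
Definition angle (s : R) : R := s + 4%:R / 5%:R * s ^+ 3.

Lemma angle_triple s : 0 <= s <= 1 / 2%:R -> 3%:R * angle s <= angle (triple s).
Proof.
case/andP=> s0 s1; rewrite /angle /triple -subr_ge0.
(* Here [triple s = 3 s t], and [s <= 1/2] gives [t >= 2/3]. As 108/5 * 8/27 = 32/5, the coefficient
   4/5 in [angle] is the least that this bound on [t] allows. *)
pose t := 1 - 4%:R / 3%:R * s ^+ 2.
have s2 : s ^+ 2 <= 1 / 4%:R by nra.
have ht : 2%:R / 3%:R <= t by rewrite /t; lra.
have ht3 : 8%:R / 27%:R <= t ^+ 3.
  have -> : 8%:R / 27%:R = (2%:R / 3%:R) ^+ 3 :> R by field.
  by rewrite lerXn2r ?nnegrE //; lra.
have -> : s * (3%:R - 4%:R * s ^+ 2) + 4%:R / 5%:R * (s * (3%:R - 4%:R * s ^+ 2)) ^+ 3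
   - 3%:R * (s + 4%:R / 5%:R * s ^+ 3)
   = s ^+ 3 * (108%:R / 5%:R * t ^+ 3 - 32%:R / 5%:R) by rewrite /t; field.
by rewrite mulr_ge0 ?exprn_ge0 //; lra.
Qed.

Lemma triple_reach n s : 0 < s <= 1 -> 1 <= 2%:R ^+ n * s ->
  exists k, 1 / 4%:R <= (iter k triple s) ^+ 2 /\ 3%:R ^+ k * s <= 9%:R / 5%:R.
Proof.
move=> s01 hn.
(* The bound 9/5 is [angle 1], the largest value of [angle] on [0, 1]; on the left,
   [s <= angle s]. *)
suff [k [h1 h2]] : exists k, 1 / 2%:R <= iter k triple s <= 1 /\
    3%:R ^+ k * angle s <= angle (iter k triple s).
  have [h3 h4] := andP h1; have [s0 _] := andP s01.
  exists k; split; first by nra.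
  apply: le_trans (_ : angle (iter k triple s) <= _); last first.
    have : (iter k triple s) ^+ 3 <= 1 by rewrite exprn_ile1 //; lra.
    by rewrite /angle; lra.
  apply: le_trans h2; rewrite ler_wpM2l ?exprn_ge0 // /angle lerDl.
  by rewrite mulr_ge0 ?exprn_ge0 //; lra.
(* [n] only drives the induction: below 1/2 the factor 3 - 4 s^2 is at least 2, so each tripling at
   least doubles [s]. *)
elim: n s s01 hn => [|n ih] s /andP[s0 s1] hn.
  exists 0%N; rewrite expr0 mul1r in hn; split; last by rewrite expr0 mul1r.
  by rewrite /= s1 andbT; lra.
have [hs|hs] := lerP (1 / 2%:R) s.
  by exists 0%N; split; [rewrite /= hs | rewrite expr0 mul1r].
have s2 : s ^+ 2 <= 1 / 4%:R by nra.
have h2 : 2%:R * s <= triple s by rewrite /triple mulrC ler_wpM2l //; lra.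
have h1 : triple s <= 1.
  (* This product equals [1 - triple s]. *)
  have : 0 <= (1 - 2%:R * s) ^+ 2 * (1 + s) by rewrite mulr_ge0 ?sqr_ge0 //; lra.
  by rewrite /triple; lra.
have [||k [hk1 hk2]] := ih (triple s).
- by apply/andP; split; lra.
- apply: le_trans hn _; rewrite exprS -mulrA mulrCA.
  by rewrite ler_wpM2l // exprn_ge0.
exists k.+1; rewrite iterSr; split=> //; apply: le_trans hk2.
rewrite exprSr -mulrA ler_wpM2l ?exprn_ge0 //.
by apply: angle_triple; apply/andP; split; lra.
Qed.

End Tripling.

(** * Repeating rounds until a measured answer bit certifies its seed *)

Section Controller.
Variable R : realType.

Lemma sum_tuple0 (T : finType) (F : seq T -> R) :
  \sum_(h : 0.-tuple T) F h = F [::].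
Proof. by rewrite (big_pred1 [tuple]) // => h; apply/esym/eqP; exact: tuple0. Qed.

Lemma sum_tuple_cons (T : finType) m (F : seq T -> R) :
  \sum_(h : m.+1.-tuple T) F h = \sum_s \sum_(h : m.-tuple T) F (s :: h).
Proof.
rewrite pair_big /= (reindex (fun x : T * m.-tuple T => [tuple of x.1 :: x.2])) //.
exists (fun h => (thead h, [tuple of behead h])) => [[s h] _|h _] /=.
  by congr pair; apply: val_inj.
by case/tupleP: h => s h; apply: val_inj.
Qed.

(** Wrapping the outcomes in [Some] gives the empty history the default [None], which starts a
    round. *)
Definition controller (Rs W : finType) (rd : nat -> qround R Rs W) : qalgo R Rs W :=
  fun h => if last None [seq Some s | s <- h] is Some (r, true, _) then QStop R W r
           else QRun (rd (size h)).

Section ControllerRun.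
Variables (Rs W : finType) (rd : nat -> qround R Rs W) (g : Rs -> bool) (p : nat -> R).
Hypothesis fail_round : forall t,
  \sum_(s | ~~ s.1.2) outprob g (rd t) s = 1 - p t.
Hypothesis hit_round : forall t,
  \sum_(s | s.1.2) outprob g (rd t) s * (g s.1.1)%:R = p t.

Let A := controller rd.

Lemma controller_rcons pre s : A (rcons pre s) =
  if s.1.2 then QStop R W s.1.1 else QRun (rd (size pre).+1).
Proof. by rewrite /A /controller map_rcons last_rcons size_rcons; case: s => [[r []] w]. Qed.

(** Treats cost (b = 0) and success (a = 0, b = 1) at once. The first term is the case where all m
    rounds failed, the second the case where round m is the first hit. The induction splits on the
    first answer bit; a history going on after a stop has weight 0. *)
Lemma sum_history (v : qaction R Rs W -> R) (a : nat -> R) (b : R) m pre :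
  (forall t, v (QRun (rd t)) = a t) ->
  (forall r, v (QStop R W r) = b * (g r)%:R) ->
  A pre = QRun (rd (size pre)) ->
  \sum_(h : m.-tuple (Rs * bool * W)%type) hprob_from A g pre h * v (A (pre ++ h)) =
  \prod_(t < m) (1 - p (size pre + t)) * a (size pre + m)%N +
  b * (if m is m'.+1 then \prod_(t < m') (1 - p (size pre + t)) * p (size pre + m')%N
       else 0).
Proof.
move=> va vb; elim: m pre => [|m ih] pre Apre.
  rewrite (sum_tuple0 (fun h => hprob_from A g pre h * v (A (pre ++ h)))).
  by rewrite /= cats0 Apre va big_ord0 addn0 mulr0 addr0.
rewrite (sum_tuple_cons m (fun h => hprob_from A g pre h * v (A (pre ++ h)))) /= Apre.
have step s : \sum_(h : m.-tuple (Rs * bool * W)%type)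
    outprob g (rd (size pre)) s * hprob_from A g (rcons pre s) h * v (A (pre ++ s :: h))
  = outprob g (rd (size pre)) s * \sum_(h : m.-tuple (Rs * bool * W)%type)
    hprob_from A g (rcons pre s) h * v (A (rcons pre s ++ h)).
  by rewrite mulr_sumr; apply: eq_bigr => h _; rewrite -cat_rcons mulrA.
under eq_bigr => s _ do rewrite step.
rewrite (bigID (fun s => s.1.2)) /=.
have stop (s : Rs * bool * W) : s.1.2 ->
  outprob g (rd (size pre)) s * (\sum_(h : m.-tuple (Rs * bool * W)%type)
    hprob_from A g (rcons pre s) h * v (A (rcons pre s ++ h)))
  = outprob g (rd (size pre)) s * (g s.1.1)%:R * (if m is 0 then b else 0).
  move=> s1; case: m {ih step} => [|m].
    rewrite (sum_tuple0 (fun h => hprob_from A g (rcons pre s) h * v (A (rcons pre s ++ h)))).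
    by rewrite /= cats0 controller_rcons s1 vb; ring.
  rewrite mulr0 big1 ?mulr0 // => h _.
  by case/tupleP: h => x h /=; rewrite controller_rcons s1 mul0r.
rewrite (eq_bigr _ stop) -mulr_suml hit_round.
under eq_bigr => s s2.
  rewrite ih; last by rewrite controller_rcons (negbTE s2) size_rcons.
  rewrite size_rcons; over.
rewrite -mulr_suml fail_round {step stop}.
rewrite big_ord_recl /= addn0.
under [in RHS]eq_bigr => t _ do rewrite /bump add1n addnS -addSn.
rewrite -!addSnnS; case: m {ih} => [|m].
  by rewrite !big_ord0 !addn0; ring.
rewrite [in X in _ = _ + X]big_ord_recl /= addn0.
under [in X in _ = _ + X]eq_bigr => t _ do rewrite /bump add1n addnS -addSn.
by rewrite -!addSnnS; ring.
Qed.

Lemma exp_cost_controller n :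
  exp_cost_upto A g n = \sum_(m < n) \prod_(t < m) (1 - p t) * (rq (rd m))%:R.
Proof.
apply: eq_bigr => m _.
rewrite (sum_history (v := fun x => (action_cost x)%:R) (a := fun t => (rq (rd t))%:R) (b := 0)
  m (pre := [::])) //= ?mul0r ?addr0 // => r.
by rewrite mul0r.
Qed.

Lemma succ_controller n : succ_upto A g n = 1 - \prod_(t < n) (1 - p t).
Proof.
have step m : \sum_(h : m.-tuple (Rs * bool * W)%type) hprob A g h * (action_success g (A h))%:R
   = if m is m'.+1 then \prod_(t < m') (1 - p t) * p m' else 0.
  rewrite (sum_history (v := fun x => (action_success g x)%:R) (a := fun=> 0) (b := 1)
    m (pre := [::])) //= ?mulr0 ?add0r ?mul1r // => r.
  by rewrite mul1r.
rewrite /succ_upto; elim: n => [|n ih].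
  by rewrite big_ord1 step big_ord0 subrr.
by rewrite big_ord_recr ih step big_ord_recr /=; ring.
Qed.

End ControllerRun.
End Controller.

(** * Real reflections as unitary operators *)

Section Reflection.
Local Open Scope complex_scope.
Variables (R : realType) (S : finType).
Implicit Types (v psi : S -> R).

(* Equals [-Id] when [v = 0], since [0^-1 = 0]. *)
Definition refl v (s t : S) : R :=
  2%:R * v s * v t / (\sum_u v u ^+ 2) - (s == t)%:R.

Definition real_op (A : S -> S -> R) : qop R S := fun s t => (A s t)%:C.

Lemma sum_delta (F : S -> R) s : \sum_t (s == t)%:R * F t = F s.
Proof.
rewrite (bigD1 s) //= eqxx mul1r big1 ?addr0 // => t; rewrite eq_sym => /negbTE ->.
by rewrite mul0r.
Qed.

Lemma qapply_real (A : S -> S -> R) (phi : qstate R S) psi s :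
  (forall t, phi t = (psi t)%:C) ->
  qapply (real_op A) phi s = (\sum_t A s t * psi t)%:C.
Proof.
by move=> phiE; rewrite rmorph_sum; apply: eq_bigr => t _; rewrite phiE rmorphM.
Qed.

Lemma refl_apply v psi s : \sum_t refl v s t * psi t =
  2%:R * v s * (\sum_t v t * psi t) / (\sum_u v u ^+ 2) - psi s.
Proof.
rewrite -[in RHS](sum_delta psi s) mulr_sumr mulr_suml -sumrB.
by apply: eq_bigr => t _; rewrite /refl; ring.
Qed.

Lemma refl_sym v s t : refl v s t = refl v t s.
Proof. by rewrite /refl [s == t]eq_sym [_ * v s * v t]mulrAC. Qed.

(** The matrix is real and symmetric, so the claim is that it squares to the identity; this follows
    because it fixes [v]. *)
Lemma unitary_refl v : unitary (real_op (refl v)).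
Proof.
move=> s t; transitivity ((\sum_u refl v s u * refl v u t)%:C).
  rewrite rmorph_sum; apply: eq_bigr => u _ /=.
  by rewrite rmorphM /real_op /= oppr0 refl_sym.
rewrite refl_apply (_ : \sum_u v u * refl v u t = v t); last first.
  under eq_bigr => u _ do rewrite refl_sym mulrC.
  rewrite refl_apply.
  (* If the norm vanishes then so does [v], and [v t = 0] is still fixed. *)
  have [V0|V0] := eqVneq (\sum_u v u ^+ 2) 0.
    have : v t == 0.
      have : v t ^+ 2 <= 0 by rewrite -V0 (bigD1 t) //= lerDl sumr_ge0 // => *; apply: sqr_ge0.
      by rewrite -sqrf_eq0 eq_le sqr_ge0 andbT.
    by move/eqP->; rewrite mulr0 !mul0r subrr.
  under eq_bigr => u _ do rewrite -expr2.
  by rewrite mulfK //; ring.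
by rewrite /refl opprB addrCA subrr addr0 rmorph_nat.
Qed.

(** Reflecting about the bisector of two unit vectors exchanges them. This prepares the state [v]
    from a basis state; [1 + v s0 != 0] says that the two are not opposite. *)
Lemma refl_ket v s0 s : \sum_u v u ^+ 2 = 1 -> 1 + v s0 != 0 ->
  \sum_t refl (fun u => (u == s0)%:R + v u) s t * (t == s0)%:R = v s.
Proof.
move=> v1 vs0; rewrite refl_apply.
have -> : \sum_t ((t == s0)%:R + v t) * (t == s0)%:R = 1 + v s0.
  transitivity (\sum_t (s0 == t)%:R * ((t == s0)%:R + v t)).
    by apply: eq_bigr => t _; rewrite mulrC [s0 == t]eq_sym.
  by rewrite sum_delta eqxx.
have -> : \sum_u ((u == s0)%:R + v u) ^+ 2 = 2%:R * (1 + v s0).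
  transitivity (\sum_u ((s0 == u)%:R * (1 + 2%:R * v u) + v u ^+ 2)).
    by apply: eq_bigr => t _; rewrite [s0 == t]eq_sym; case: (t == s0) => /=; ring.
  by rewrite big_split /= sum_delta v1; ring.
by field.
Qed.

End Reflection.

(** * Grover iterations as powers of a unit complex number *)

Section Grover.
Local Open Scope complex_scope.
Variables (R : realType) (Rs : finType).
Local Notation S := (Rs * bool * bool)%type.

Lemma sum_reg (F : S -> R) :
  \sum_s F s = \sum_r (F (r, true, true) + F (r, true, false) +
                       (F (r, false, true) + F (r, false, false))).
Proof.
transitivity (\sum_r \sum_b \sum_w F (r, b, w)).
  by rewrite pair_bigA pair_bigA /=; apply: eq_bigr => [[[r b] w]].
by apply: eq_bigr => r _; rewrite !big_bool.
Qed.

(* phi tensored with (|0> - |1>)/sqrt 2 on the answer bit and |0> on the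
   workspace: on such states the bit-flip oracle acts as a phase oracle. *)
Definition layer (phi : Rs -> R) (s : S) : R :=
  if s.2 then 0 else (-1) ^+ s.1.2 * phi s.1.1 / Num.sqrt 2%:R.

Lemma sqrt2K : Num.sqrt 2%:R ^+ 2 = 2%:R :> R.
Proof. by rewrite sqr_sqrtr. Qed.

Lemma layer_dot phi psi :
  \sum_s layer phi s * layer psi s = \sum_r phi r * psi r.
Proof.
rewrite sum_reg; apply: eq_bigr => r _; rewrite /layer /= expr1 expr0.
have n0 : Num.sqrt 2%:R != 0 :> R by rewrite sqrtr_eq0 -ltNge.
transitivity (2%:R * (phi r * psi r) / Num.sqrt 2%:R ^+ 2); first by field.
by rewrite sqrt2K; field.
Qed.

Definition uniform : Rs -> R := fun=> (Num.sqrt #|Rs|%:R)^-1.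

Lemma uniform_norm : (0 < #|Rs|)%N -> \sum_s layer uniform s ^+ 2 = 1.
Proof.
move=> N0; under eq_bigr => s _ do rewrite expr2.
rewrite layer_dot /uniform sumr_const -expr2 exprVn sqr_sqrtr ?ler0n //.
by rewrite -[LHS]mulr_natl mulfV // pnatr_eq0 -lt0n.
Qed.

(** Grover's inversion about the mean. It preserves the states of the form [layer phi], so the
    answer bit stays ready for the next phase query. *)
Lemma diffusion phi s : (0 < #|Rs|)%N ->
  \sum_t refl (layer uniform) s t * layer phi t =
  layer (fun r => 2%:R * (\sum_r phi r) / #|Rs|%:R - phi r) s.
Proof.
move=> N0; rewrite refl_apply uniform_norm // divr1 layer_dot -mulr_sumr.
rewrite /layer; case: s.2; first by rewrite mulr0 mul0r subrr.
have -> : #|Rs|%:R^-1 = uniform s.1.1 ^+ 2.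
  by rewrite /uniform exprVn sqr_sqrtr ?ler0n.
by rewrite /uniform; ring.
Qed.

Variable g : Rs -> bool.

Lemma oracle_apply (W : finType) (psi : qstate R (Rs * bool * W)%type) s :
  qapply (@oracle R Rs W g) psi s = psi (s.1.1, s.1.2 (+) g s.1.1, s.2).
Proof.
case: s => [[r b] w]; rewrite /qapply (bigD1 (r, b (+) g r, w)) //= /oracle /=.
rewrite addbK !eqxx mul1r big1 ?addr0 // => [[[r' b'] w']] /= ne.
case: eqP => [er|_] /=; last by rewrite mul0r.
case: eqP => [eb|_] /=; last by rewrite mul0r.
case: eqP => [ew|_] /=; last by rewrite mul0r.
by move: ne; rewrite er eb ew addbK eqxx.
Qed.

Lemma layer_oracle phi (s : S) :
  layer phi (s.1.1, s.1.2 (+) g s.1.1, s.2) = layer (fun r => (-1) ^+ g r * phi r) s.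
Proof. by rewrite /layer /=; case: s.2 => //; rewrite signr_addb !mulrA. Qed.

Let x : R := Num.sqrt (#|[pred r | g r]|%:R).
Let y : R := Num.sqrt (#|[pred r | ~~ g r]|%:R).
Let n : R := Num.sqrt (#|Rs|%:R).

(** This is e^(i theta) with sin theta = sqrt (h / N), h being the number of good seeds and N that
    of all seeds. Its powers replace trigonometric functions. *)
Definition grover_pt : R[i] := (y / n) +i* (x / n).

(** Amplitude of one seed after i iterations: sin ((2i+1) theta) spread evenly over the good seeds,
    cos ((2i+1) theta) over the bad ones. A branch with zero divisor is taken by no seed. *)
Definition amp (i : nat) (r : Rs) : R :=
  if g r then complex.Im (grover_pt ^+ i.*2.+1) / x
  else complex.Re (grover_pt ^+ i.*2.+1) / y.

Lemma card_sqrt : x ^+ 2 + y ^+ 2 = n ^+ 2.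
Proof.
rewrite /x /y /n !sqr_sqrtr ?ler0n // -natrD -(cardC [pred r | g r]).
by congr (_ + _)%:R; apply: eq_card.
Qed.

Lemma n_neq0 : (0 < #|Rs|)%N -> n != 0.
Proof. by move=> N0; rewrite /n sqrtr_eq0 -ltNge ltr0n. Qed.

Lemma good_neq0 r : g r -> x != 0.
Proof. by move=> gr; rewrite /x sqrtr_eq0 -ltNge ltr0n; apply/card_gt0P; exists r. Qed.

Lemma bad_neq0 r : ~~ g r -> y != 0.
Proof. by move=> gr; rewrite /y sqrtr_eq0 -ltNge ltr0n; apply/card_gt0P; exists r. Qed.

Lemma sum_split (a b : R) : \sum_r (if g r then a else b) = x ^+ 2 * a + y ^+ 2 * b.
Proof.
rewrite /x /y !sqr_sqrtr ?ler0n // !mulr_natl -!sumr_const.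
rewrite (bigID g) /=; congr (_ + _); apply: eq_big => r //=.
  by move=> ->.
by move/negbTE => ->.
Qed.

Lemma amp0 r : (0 < #|Rs|)%N -> amp 0 r = uniform r.
Proof.
move=> N0; rewrite /amp /uniform /=; case: ifPn => gr.
  by rewrite mulrAC divff ?mul1r // (good_neq0 gr).
by rewrite mulrAC divff ?mul1r // (bad_neq0 gr).
Qed.

(** A phase query followed by the diffusion rotates by 2 theta, that is, multiplies by the square of
    [grover_pt]. *)
Lemma ampS i r : (0 < #|Rs|)%N ->
  2%:R * (\sum_r (-1) ^+ g r * amp i r) / #|Rs|%:R - (-1) ^+ g r * amp i r = amp i.+1 r.
Proof.
move=> N0; have n0 := n_neq0 N0.
have nE : #|Rs|%:R = n ^+ 2 by rewrite sqr_sqrtr ?ler0n.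
rewrite nE /amp doubleS (exprS _ i.*2.+2) (exprS _ i.*2.+1).
case zE : (grover_pt ^+ i.*2.+1) => [c s] /=.
have -> : \sum_r0 (-1) ^+ g r0 * (if g r0 then s / x else c / y) = - x * s + y * c.
  rewrite -[LHS](_ : \sum_r (if g r then - (s / x) else c / y) = _); last first.
    by apply: eq_bigr => r' _; case: (g r'); rewrite ?mulN1r ?mul1r.
  rewrite sum_split; congr (_ + _).
    by have [->|x0] := eqVneq x 0; [rewrite expr0n /= oppr0 !mul0r | field].
  by have [->|y0] := eqVneq y 0; [rewrite expr0n /= !mul0r | field].
have cs := card_sqrt.
case: ifPn => gr /=.
  have x0 := good_neq0 gr; rewrite expr1.
  apply: (mulfI (expf_neq0 2 n0)); apply: (mulfI x0).
  apply/eqP; rewrite -subr_eq0; apply/eqP.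
  (* Once denominators are cleared, the two sides differ by a multiple of x^2 + y^2 - n^2. *)
  transitivity (s * (n ^+ 2 - (x ^+ 2 + y ^+ 2))); last by rewrite cs subrr mulr0.
  by field; rewrite n0 x0.
have y0 := bad_neq0 gr; rewrite expr0.
apply: (mulfI (expf_neq0 2 n0)); apply: (mulfI y0).
apply/eqP; rewrite -subr_eq0; apply/eqP.
transitivity (c * ((x ^+ 2 + y ^+ 2) - n ^+ 2)); last by rewrite cs subrr mulr0.
by field; rewrite n0 y0.
Qed.

End Grover.

(** * A single round and its outcome probabilities *)

Section Round.
Local Open Scope complex_scope.
Variables (R : realType) (Rs : finType).
Local Notation S := (Rs * bool * bool)%type.

(* [j] Grover iterations; then the answer bit is swapped with the fresh
   workspace bit and one more query writes [g r] into it, so that the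
   measurement certifies its own outcome.  The last operator is [-Id]. *)
Definition round_vec (r0 : Rs) (j i : nat) : S -> R :=
  if i == j.+1 then fun=> 0
  else if i == 0%N then fun u => (u == (r0, false, false))%:R + layer (uniform R (Rs := Rs)) u
  else layer (uniform R (Rs := Rs)).

Definition swap_bits (s : S) : S := (s.1.1, s.2, s.1.2).

Definition grover_round (r0 : Rs) (j : nat) : qround R Rs bool :=
  QRound j.+1 (r0, false, false)
    (fun i => real_op (fun s t => refl (round_vec r0 j i) (if i == j then swap_bits s else s) t)).

Lemma grover_round_wf r0 j : round_wf (grover_round r0 j).
Proof.
move=> i _ s t /=; case: (i == j); last exact: unitary_refl.
(* The swap only permutes the rows of a unitary matrix, so it reindexes the sum. *)
rewrite -[RHS](unitary_refl (round_vec r0 j i)) [RHS](reindex_inj (h := swap_bits)) //.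
by move=> [[r b] w] [[r' b'] w'] [-> -> ->].
Qed.

Variables (g : Rs -> bool) (r0 : Rs).
Local Notation x := (Num.sqrt #|[pred r | g r]|%:R : R).
Local Notation y := (Num.sqrt #|[pred r | ~~ g r]|%:R : R).
Local Notation pt := (grover_pt R g).

Lemma seeds_gt0 : (0 < #|Rs|)%N.
Proof. by apply/card_gt0P; exists r0. Qed.

Lemma run_grover_round j i s : (i <= j)%N ->
  run_from g (ru (grover_round r0 j)) i (ket R (r0, false, false)) s =
  (layer (amp R g i) (if i == j then swap_bits s else s))%:C.
Proof.
have N0 := seeds_gt0.
elim: i s => [|i ih] s ij.
  rewrite /= (@qapply_real R _ _ _ (fun t => (t == (r0, false, false))%:R)); last first.
    by move=> t; rewrite rmorph_nat.
  rewrite /round_vec eqxx (_ : (0%N == j.+1) = false) // refl_ket.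
  - by congr (_%:C); rewrite /layer; case: ifP => // _; rewrite amp0.
  - exact: uniform_norm.
  rewrite /layer /= expr0 mul1r gt_eqF // ltr_pwDl //.
  by rewrite divr_ge0 ?invr_ge0 ?sqrtr_ge0.
rewrite /= (@qapply_real R _ _ _ (layer (fun r => (-1) ^+ g r * amp R g i r))); last first.
  move=> t; rewrite oracle_apply ih; last exact: ltnW.
  by rewrite (ltn_eqF ij) layer_oracle.
have -> : round_vec r0 j i.+1 = layer (uniform R (Rs := Rs)).
  by rewrite /round_vec eqSS (ltn_eqF ij).
rewrite diffusion //; congr (_%:C); rewrite /layer; case: ifP => // _.
by rewrite -ampS.
Qed.

Lemma outprob_grover_round j s : outprob g (grover_round r0 j) s =
  if s.1.2 == g s.1.1 then amp R g j s.1.1 ^+ 2 / 2%:R else 0.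
Proof.
pose psi := fun t : S => layer (amp R g j) (swap_bits (t.1.1, t.1.2 (+) g t.1.1, t.2)).
rewrite /outprob /round_state [rq _]/= [rinit _]/=.
have -> : run_from g (ru (grover_round r0 j)) j.+1 (ket R (r0, false, false)) s = (- psi s)%:C.
  rewrite /= (@qapply_real R _ _ _ psi); last first.
    by move=> t; rewrite oracle_apply run_grover_round // eqxx.
  rewrite (gtn_eqF (ltnSn j)) refl_apply /round_vec eqxx.
  by rewrite mulr0 !mul0r sub0r.
rewrite /sqmod /= expr0n addr0 sqrrN /psi /layer /=.
case: s => [[r b] w] /=; rewrite (_ : b (+) g r = ~~ (b == g r)); last by case: b; case: (g r).
case: (b == g r) => /=; last by rewrite expr0n.
by rewrite expr_div_n exprMn sqrr_sign mul1r sqrt2K.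
Qed.

Lemma normsq_pow (z : R[i]) n : complex.Re z ^+ 2 + complex.Im z ^+ 2 = 1 ->
  complex.Re (z ^+ n) ^+ 2 + complex.Im (z ^+ n) ^+ 2 = 1.
Proof.
move=> z1; elim: n => [|n ih]; first by rewrite expr0 /= expr1n expr0n addr0.
rewrite [z ^+ n.+1]exprS; move: z1 ih; case: (z ^+ n) => c s; case: z => a b /= z1 ih.
transitivity ((a ^+ 2 + b ^+ 2) * (c ^+ 2 + s ^+ 2)); first by ring.
by rewrite z1 ih mulr1.
Qed.

Lemma normsq_pt : complex.Re pt ^+ 2 + complex.Im pt ^+ 2 = 1.
Proof.
rewrite /= !expr_div_n -mulrDl addrC card_sqrt divff // expf_neq0 //.
exact: n_neq0 seeds_gt0.
Qed.

Lemma hit_grover_round j : (0 < #|[pred r | g r]|)%N ->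
  \sum_(s : S | s.1.2) outprob g (grover_round r0 j) s * (g s.1.1)%:R =
  complex.Im (pt ^+ j.*2.+1) ^+ 2.
Proof.
move=> h0; have x0 : x != 0 by rewrite sqrtr_eq0 -ltNge ltr0n.
rewrite big_mkcond sum_reg /=.
transitivity (\sum_r (if g r then complex.Im (pt ^+ j.*2.+1) ^+ 2 / x ^+ 2 else 0)).
  apply: eq_bigr => r _; rewrite !outprob_grover_round /= /amp.
  by case: (g r) => /=; [field | ring].
by rewrite sum_split mulr0 addr0; field.
Qed.

Lemma fail_grover_round j :
  \sum_(s : S | ~~ s.1.2) outprob g (grover_round r0 j) s =
  1 - complex.Im (pt ^+ j.*2.+1) ^+ 2.
Proof.
rewrite big_mkcond sum_reg /=.
transitivity (\sum_r (if g r then 0 else complex.Re (pt ^+ j.*2.+1) ^+ 2 / y ^+ 2)).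
  apply: eq_bigr => r _; rewrite !outprob_grover_round /= /amp.
  case gr: (g r) => /=; first by rewrite !addr0.
  by have y0 := bad_neq0 R (negbT gr); field.
rewrite sum_split mulr0 add0r -[X in X - _](normsq_pow j.*2.+1 normsq_pt) addrK.
(* When every seed is good, [pt] is purely imaginary and its odd powers have real part 0. *)
have [y0|y0] := eqVneq y 0; last by field.
rewrite y0 expr0n mul0r /grover_pt y0 mul0r.
set v := _ / _; suff -> : complex.Re ((0 +i* v) ^+ j.*2.+1) = 0 by rewrite expr0n.
elim: j => [|j ih]; first by [].
rewrite doubleS (exprS _ j.*2.+2) (exprS _ j.*2.+1); move: ih; case: (_ ^+ j.*2.+1) => a b /= ->.
by ring.
Qed.

(** The triple-angle formula: the cube of a + ib has imaginary part b (3 a^2 - b^2), and a^2 = 1 -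
    b^2 on the unit circle. *)
Lemma Im_pow_triple (z : R[i]) k : complex.Re z ^+ 2 + complex.Im z ^+ 2 = 1 ->
  complex.Im (z ^+ (3 ^ k)) = iter k (@triple R) (complex.Im z).
Proof.
move=> z1; elim: k => [|k ih]; first by rewrite expn0 expr1.
rewrite iterS -ih expnSr exprM.
have := normsq_pow (3 ^ k) z1; case: (z ^+ (3 ^ k)) => a b /= ab.
have a2 : a ^+ 2 = 1 - b ^+ 2 by rewrite -ab addrK.
transitivity (b * (3%:R * a ^+ 2 - b ^+ 2)); first by ring.
by rewrite a2 /triple; ring.
Qed.

End Round.

(** * The search algorithm for a fixed predicate *)

Section Search.
Variables (R : realType) (Rs : finType) (r0 : Rs).

Definition grover_search : qalgo R Rs bool :=
  controller (fun t => grover_round R r0 (3 ^ ruler t)./2).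

Lemma grover_search_wf : qalgo_wf grover_search.
Proof.
move=> h; rewrite /grover_search /controller.
case: (last _ _) => [[[r []] w]|] //=; exact: grover_round_wf.
Qed.

Variable g : Rs -> bool.
Hypothesis good : (0 < #|[pred r | g r]|)%N.
Local Notation ratio := (#|Rs|%:R / #|[pred r | g r]|%:R : R).

Let q (i : nat) : R := complex.Im (grover_pt R g ^+ (3 ^ i)) ^+ 2.

Lemma hit_prob_itv i : 0 <= q i <= 1.
Proof.
rewrite sqr_ge0 /= -[leRHS](normsq_pow (3 ^ i) (normsq_pt R g r0)).
by rewrite lerDr sqr_ge0.
Qed.

Lemma half_exp3 i : ((3 ^ i)./2).*2.+1 = (3 ^ i)%N.
Proof. by rewrite -[RHS]odd_double_half oddX orbT. Qed.

Lemma hit_prob_reach : exists k, 1 / 4%:R <= q k /\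
  3%:R ^+ k <= 9%:R / 5%:R * Num.sqrt ratio.
Proof.
have N0 : 0 < #|Rs|%:R :> R by rewrite ltr0n (seeds_gt0 r0).
have h0 : 0 < #|[pred r | g r]|%:R :> R by rewrite ltr0n.
pose s : R := complex.Im (grover_pt R g).
have sE : s * Num.sqrt ratio = 1.
  rewrite /s /= sqrtrM ?ler0n // sqrtrV ?ler0n // mulrA divfK ?divff //.
    by rewrite sqrtr_eq0 -ltNge.
  by rewrite sqrtr_eq0 -ltNge.
have r1 : 0 < Num.sqrt ratio by rewrite sqrtr_gt0 divr_gt0.
have s0 : 0 < s by rewrite -(pmulr_lgt0 _ r1) sE.
have s1 : s <= 1.
  have := normsq_pt R g r0; rewrite -/s; move: (complex.Re _) => a ha.
  have := sqr_ge0 a; nra.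
(* Any [n] with [1 <= 2 ^ n * s] would do; it does not enter the bound on [k]. *)
pose n := (Num.truncn (Num.sqrt ratio)).+1.
have [||k [k1 k2]] := @triple_reach R n s.
- by rewrite s0 s1.
- rewrite -[leLHS]sE mulrC ler_pM2r //; apply: ltW.
  apply: lt_le_trans (truncnS_gt _) _.
  by rewrite -natrX ler_nat ltnW // ltn_expl.
exists k; rewrite /q (Im_pow_triple k (normsq_pt R g r0)); split=> //.
by rewrite -(ler_pM2r s0) -(mulrA (9%:R / 5%:R)) (mulrC (Num.sqrt _) s) sE mulr1.
Qed.

Lemma grover_search_fail t :
  \sum_(s | ~~ s.1.2) outprob g (grover_round R r0 (3 ^ ruler t)./2) s = 1 - q (ruler t).
Proof. by rewrite fail_grover_round half_exp3. Qed.

Lemma grover_search_hit t :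
  \sum_(s | s.1.2) outprob g (grover_round R r0 (3 ^ ruler t)./2) s * (g s.1.1)%:R
  = q (ruler t).
Proof. by rewrite hit_grover_round // half_exp3. Qed.

Lemma grover_search_succ eps : 0 < eps ->
  exists n, 1 - eps <= succ_upto grover_search g n.
Proof.
move=> e0; have [k [qk _]] := hit_prob_reach.
have [n hn] := failprob_cvg0 hit_prob_itv qk e0.
by exists n; rewrite (succ_controller grover_search_fail grover_search_hit) lerD2l lerN2.
Qed.

Lemma grover_search_cost n :
  exp_cost_upto grover_search g n <= 627%:R * Num.sqrt ratio.
Proof.
have [k [qk hk]] := hit_prob_reach.
rewrite (exp_cost_controller grover_search_fail grover_search_hit).
apply: (@le_trans _ _ (\sum_(m < n) failprob q m * 3%:R ^+ ruler m)).
  apply: ler_sum => m _; apply: ler_wpM2l.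
    by apply: failprob_ge0 => i; case/andP: (hit_prob_itv i).
  (* With 3^i = 2j + 1, a round at scale i makes j + 1 <= 3^i queries, the certifying one
     included. *)
  by rewrite -natrX ler_nat /= -[leqRHS]half_exp3 ltnS -addnn leq_addr.
apply: le_trans (sum_failprob_cost n hit_prob_itv qk) _.
(* The constant comes from 348 * 9/5 = 626.4 <= 627. *)
have : 0 <= 2%:R ^+ k :> R by rewrite exprn_ge0.
by have := sqrtr_ge0 ratio; lra.
Qed.

End Search.

(** * Averaging over the distribution of f *)

Lemma mean_sqrt_le (R : rcfType) (I : finType) (F : {set I}) (P a : I -> R) :
  (forall i, i \in F -> 0 <= P i) -> \sum_(i in F) P i = 1 -> (forall i, 0 <= a i) ->
  \sum_(i in F) P i * Num.sqrt (a i) <= Num.sqrt (\sum_(i in F) P i * a i).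
Proof.
move=> P0 P1 a0; set mu := \sum_(i in F) P i * Num.sqrt (a i).
have mu0 : 0 <= mu by apply: sumr_ge0 => i iF; rewrite mulr_ge0 ?P0 ?sqrtr_ge0.
rewrite -[leLHS]ger0_norm // -sqrtr_sqr ler_wsqrtr // -subr_ge0.
(* The gap is the variance of [Num.sqrt (a i)] under [P]. *)
suff -> : \sum_(i in F) P i * a i - mu ^+ 2 = \sum_(i in F) P i * (Num.sqrt (a i) - mu) ^+ 2.
  by apply: sumr_ge0 => i iF; rewrite mulr_ge0 ?P0 ?sqr_ge0.
transitivity (\sum_(i in F) (P i * a i - 2%:R * mu * (P i * Num.sqrt (a i)) + mu ^+ 2 * P i)).
  by rewrite big_split sumrB -!mulr_sumr -/mu P1 /=; ring.
apply: eq_bigr => i _; move: (sqr_sqrtr (a0 i)); move: (Num.sqrt (a i)) => t <-.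
by ring.
Qed.

Theorem theorem4 (R : realType) :
  exists c : R, 0 < c /\
  forall (X Rs : finType) (Fam : {set {ffun X -> bool}})
         (P : {ffun X -> bool} -> R) (G : {ffun X -> bool} -> Rs -> X),
    (forall f, f \in Fam -> 0 <= P f) ->
    \sum_(f in Fam) P f = 1 ->
    (forall f, f \in Fam -> 0 < P f -> (0 < hcount G f)%N) ->
    exists (W : finType) (A : qalgo R Rs W),
      qalgo_wf A /\
      (* Las Vegas correctness: for every f in the support of D, the
         algorithm stops with a seed r such that f (G f r) = 1 with
         probability 1 *)
      (forall f, f \in Fam -> 0 < P f ->
         forall eps : R, 0 < eps ->
           exists n : nat, 1 - eps <= succ_upto A (fun r => f (G f r)) n) /\
      (* expected number of oracle calls, over D and the algorithm's
         randomness, is at most c * sqrt T *)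
      (forall n : nat,
         \sum_(f in Fam) P f * exp_cost_upto A (fun r => f (G f r)) n
           <= c * Num.sqrt (classical_T Fam P G)).
Proof.
exists 627%:R; split=> // X Rs Fam P G P0 P1 hG.
(* Some member has positive probability, hence a good seed; that seed serves to initialise the
   register. *)
have [f0 f0F Pf0] : exists2 f, f \in Fam & 0 < P f.
  apply/exists_inP; apply: contraPT P1 => /exists_inPn no.
  rewrite big1 => [/eqP|f fF]; first by rewrite eq_sym oner_eq0.
  by apply/eqP; rewrite eq_le P0 // leNgt no.
have cardE f : hcount G f = #|[pred r | f (G f r)]|.
  by apply: eq_card => r; rewrite !inE.
have /card_gt0P [r0 _] : (0 < hcount G f0)%N by exact: hG.
exists bool, (grover_search R r0); split; first exact: grover_search_wf.
split=> [f fF Pf eps e0 | n].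
  by apply: grover_search_succ => //; rewrite -cardE hG.
rewrite /classical_T.
have ratio0 f : 0 <= #|Rs|%:R / (hcount G f)%:R :> R by rewrite divr_ge0 ?ler0n.
apply: le_trans (ler_wpM2l _ (mean_sqrt_le P0 P1 ratio0)) => //.
rewrite mulr_sumr; apply: ler_sum => f fF; rewrite mulrCA.
(* A member of probability 0 contributes 0 to both sides; the cost bound is applied only where
   [hcount] is positive. *)
have := P0 f fF; rewrite le_eqVlt => /predU1P[<-|Pf]; first by rewrite !mul0r.
rewrite ler_pM2l // cardE; apply: grover_search_cost.
by rewrite -cardE hG.
Qed.
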